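(* Let $\alpha_1,\alpha_2,\beta_1,\beta_2>0$, $\nu\in(0,1)$, and let $X^\nu(t):=X^1(T^\nu(t))$ be the time-changed process described in the context. For $k\in\mathbb{Z}$, $t\geq0$ let $F_k^\nu(z,t):=\mathbb{E}[z^{X^\nu(t)}|X^\nu(0)=k]=\sum_{n=-\infty}^\infty z^nP(X^\nu(t)=n|X^\nu(0)=k)$. Then, for every $z>0$, $$F_k^\nu(z,t)=z^k\left(\frac{E_\nu(\hat h_-(z)t^\nu)+E_\nu(\hat h_+(z)t^\nu)}{2}+\frac{c_k(z)}{h(z)}\cdot\frac{E_\nu(\hat h_+(z)t^\nu)-E_\nu(\hat h_-(z)t^\nu)}{2}\right),$$ where $E_\nu$ is the Mittag-Leffler function and $c_k,h,\hat h_\pm$ are as in the context.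
   Context: $\{X^1(t):t\geq 0\}$ is the continuous-time Markov chain on $\mathbb{Z}$ whose state probabilities $p_{k,n}(t):=P(X^1(t)=n|X^1(0)=k)$ satisfy $p_{k,n}(0)=1_{\{k=n\}}$ and whose generator $g_{k,n}:=\lim_{t\to 0}\frac{p_{k,n}(t)-p_{k,n}(0)}{t}$ is as follows. For even $k$: $g_{k,k+1}=\alpha_1$, $g_{k,k-1}=\alpha_2$, $g_{k,k}=-(\alpha_1+\alpha_2)$. For odd $k$: $g_{k,k+1}=\beta_1$, $g_{k,k-1}=\beta_2$, $g_{k,k}=-(\beta_1+\beta_2)$. All other entries are $0$. $\{S^\nu(t):t\geq0\}$ is the $\nu$-stable subordinator, with $\mathbb{E}[e^{\gamma S^\nu(t)}]=e^{-|\gamma|^\nu t}$ for $\gamma\leq0$, and $\{T^\nu(t):t\geq0\}$ is its inverse, $T^\nu(t)=\inf\{s\geq0:S^\nu(s)>t\}$; it is independent of $X^1$, $T^\nu(0)=0$, and $\mathbb{E}[e^{\gamma T^\nu(t)}]=E_\nu(\gamma t^\nu)$. The Mittag-Leffler function is $E_\nu(x):=\sum_{j\geq0}\frac{x^j}{\Gamma(\nu j+1)}$, $x\in\mathbb{R}$. For $z>0$: $h(z):=\frac12\sqrt{(\alpha_1+\alpha_2-(\beta_1+\beta_2))^2z^2+4(\beta_1z^2+\beta_2)(\alpha_1z^2+\alpha_2)}$; $\hat h_\pm(z):=-\frac{\alpha_1+\alpha_2+\beta_1+\beta_2}{2}\pm\frac{h(z)}{z}$; $c_k(z):=\frac{(\beta_1+\beta_2-(\alpha_1+\alpha_2))z}{2}+\alpha_1z^2+\alpha_2$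 if $k$ is even, and $c_k(z):=\frac{(\alpha_1+\alpha_2-(\beta_1+\beta_2))z}{2}+\beta_1z^2+\beta_2$ if $k$ is odd. *)

(* Defs.v *)
From HB Require Import structures.
From mathcomp Require Import all_boot all_order all_algebra.
From mathcomp Require Import all_classical all_reals all_analysis.

Set Implicit Arguments.
Unset Strict Implicit.
Unset Printing Implicit Defensive.

Import Order.TTheory GRing.Theory Num.Theory.
Import numFieldNormedType.Exports.

Local Open Scope classical_set_scope.
Local Open Scope ring_scope.

(* Intended for x > 0, where the integral converges. *)
Definition Gamma (R : realType) (x : R) : R :=
  (\int[lebesgue_measure]_(u in `]0, +oo[) (u `^ (x - 1) * expR (- u)))%R.

Definition mittag_leffler (R : realType) (nu x : R) : R :=
  limn (series (fun j : nat => x ^+ j / Gamma (nu * j%:R + 1))).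

(* A process is a function [R -> Omega -> E] of which only the times t >= 0
   matter. *)

(* The sigma-algebra generated by a process whose state space E carries the
   sigma-algebra M. *)
Definition process_events (R : realType) (d : measure_display)
    (Omega : measurableType d) (E : Type) (M : set (set E))
    (Y : R -> Omega -> E) : set (set Omega) :=
  <<s [set A | exists2 t : R, 0 <= t & exists2 B, M B & A = Y t @^-1` B] >>.

Definition independent_families (R : realType) (d : measure_display)
    (Omega : measurableType d) (P : probability Omega R)
    (G H : set (set Omega)) : Prop :=
  forall A B : set Omega, G A -> H B -> P (A `&` B) = (P A * P B)%E.

(* P(A | B), meaningful when 0 < P B. *)
Definition cond_prob (R : realType) (d : measure_display)
    (Omega : measurableType d) (P : probability Omega R) (B A : set Omega) : R :=
  fine (P (A `&` B)) / fine (P B).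

(* E[f | B], meaningful when 0 < P B. *)
Definition cond_expectation (R : realType) (d : measure_display)
    (Omega : measurableType d) (P : probability Omega R)
    (B : set Omega) (f : Omega -> R) : \bar R :=
  ((\int[P]_(w in B) (f w)%:E) * ((fine (P B))^-1)%:E)%E.

(* p k n t is the probability of going from k to n in time t. *)
Definition transition_function (R : realType) (p : int -> int -> R -> R) : Prop :=
  [/\ forall k n t, 0 <= t -> 0 <= p k n t,
      forall k t, 0 <= t -> (\esum_(n in [set: int]) (p k n t)%:E = 1)%E,
      forall k n, p k n 0 = (k == n)%:R
    & forall k n s t, 0 <= s -> 0 <= t ->
        (\esum_(j in [set: int]) (p k j s * p j n t)%:E = (p k n (s + t))%:E)%E].

Definition has_generator (R : realType) (p : int -> int -> R -> R)
    (g : int -> int -> R) : Prop :=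
  forall k n, (p k n t - p k n 0) / t @[t --> 0^'+] --> g k n.

(* The third clause is the Markov property
     P(X(t) = l | X(s_0) = n_0, ..., X(s_m) = n_m) = p_{n_m, l}(t - s_m),
   multiplied out so that it also makes sense for null conditioning events.
   With m = 0 and s_0 = 0 it gives p_{k,n}(t) = P(X(t) = n | X(0) = k).
   The second clause is right continuity for the discrete topology; it makes X
   jointly measurable, so that X can be evaluated at a random time. *)
Definition markov_chain (R : realType) (d : measure_display)
    (Omega : measurableType d) (P : probability Omega R)
    (X : R -> Omega -> int) (p : int -> int -> R -> R) : Prop :=
  [/\ forall t (B : set int), 0 <= t -> measurable (X t @^-1` B),
      forall w t, 0 <= t -> \forall s \near t^'+, X s w = X t w
    & forall (m : nat) (s : nat -> R) (n : nat -> int) (t : R) (l : int),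
        0 <= s 0%N -> (forall i, (i < m)%N -> s i <= s i.+1) ->
        s m <= t ->
        let past := [set w | forall i, (i <= m)%N -> X (s i) w = n i] in
        (P (past `&` X t @^-1` [set l]) = P past * (p (n m) l (t - s m))%:E)%E].

Definition alternating_generator (R : realType) (a1 a2 b1 b2 : R) (k n : int) : R :=
  let up := if (2 %| k)%Z then a1 else b1 in
  let down := if (2 %| k)%Z then a2 else b2 in
  if n == k + 1 then up
  else if n == k - 1 then down
  else if n == k then - (up + down)
  else 0.

Definition stable_subordinator (R : realType) (d : measure_display)
    (Omega : measurableType d) (P : probability Omega R)
    (nu : R) (S : R -> Omega -> R) : Prop :=
  [/\ forall t, 0 <= t -> measurable_fun [set: Omega] (S t),
      forall w, [/\ S 0 w = 0,
                    forall s t, 0 <= s -> s <= t -> S s w <= S t w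
                  & forall t, 0 <= t -> S s w @[s --> t^'+] --> S t w],
      forall (m : nat) (s : nat -> R) (B : nat -> set R),
        0 <= s 0%N -> (forall i, (i < m)%N -> s i <= s i.+1) ->
        (forall i, measurable (B i)) ->
        let incr i := (S (s i.+1) \- S (s i)) @^-1` B i in
        (P (\bigcap_(i in `I_m) incr i) = \prod_(i < m) P (incr i))%E,
      forall (s t : R) (B : set R), 0 <= s -> 0 <= t -> measurable B ->
        P ((S (s + t) \- S s) @^-1` B) = P (S t @^-1` B)
    & forall gamma t : R, gamma <= 0 -> 0 <= t ->
        ('E_P[fun w => expR (gamma * S t w)]
          = (expR (- (`|gamma| `^ nu) * t))%:E)%E].

(* [inf set0 = 0] is irrelevant: S t w tends to +oo with t for almost all w. *)
Definition inverse_subordinator (R : realType) (Omega : Type)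
    (S : R -> Omega -> R) (t : R) (w : Omega) : R :=
  inf [set s | 0 <= s /\ t < S s w].

Definition hfun (R : realType) (a1 a2 b1 b2 z : R) : R :=
  2^-1 * Num.sqrt ((a1 + a2 - (b1 + b2)) ^+ 2 * z ^+ 2
                   + 4 * (b1 * z ^+ 2 + b2) * (a1 * z ^+ 2 + a2)).

Definition hhat_plus (R : realType) (a1 a2 b1 b2 z : R) : R :=
  - ((a1 + a2 + b1 + b2) / 2) + hfun a1 a2 b1 b2 z / z.

Definition hhat_minus (R : realType) (a1 a2 b1 b2 z : R) : R :=
  - ((a1 + a2 + b1 + b2) / 2) - hfun a1 a2 b1 b2 z / z.

Definition cfun (R : realType) (a1 a2 b1 b2 : R) (k : int) (z : R) : R :=
  if (2 %| k)%Z
  then (b1 + b2 - (a1 + a2)) * z / 2 + a1 * z ^+ 2 + a2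
  else (a1 + a2 - (b1 + b2)) * z / 2 + b1 * z ^+ 2 + b2.

(* Main.v *)
Require Import Defs.
From HB Require Import structures.
From mathcomp Require Import all_boot all_order all_algebra.
From mathcomp Require Import all_classical all_reals all_analysis.
From mathcomp Require Import measurable_realfun.
From mathcomp Require Import ring lra zify.

Set Implicit Arguments.
Unset Strict Implicit.
Unset Printing Implicit Defensive.

Import Order.TTheory GRing.Theory Num.Theory.
Import numFieldNormedType.Exports.

Local Open Scope classical_set_scope.
Local Open Scope ring_scope.

(** The rates are bounded, so the backward equation p' = G p, with G the
    generator, determines p: writing J = G + lam I with lam at least every rate,
    r(t) = e^(lam t) p(t) satisfies r' = J r, its m-th derivative J^m r is bounded
    by lam^m e^(lam t), and its Taylor series sum_m t^m/m! J^m converges to it.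
    Since J is entrywise nonnegative, summing against z^n may be exchanged with
    the series, and n |-> z^n is the sum of two eigenvectors of G, for the
    eigenvalues hhat_plus and hhat_minus; hence
      sum_n z^n p_(k,n)(t) = e^(hhat_plus t) g1(k) + e^(hhat_minus t) g2(k).
    By independence and right continuity, P(X(0) = k, X(T(t)) = n) is
    P(X(0) = k) E[p_(k,n)(T(t))], so that F is obtained from the formula above by
    replacing e^(gamma t) with E[e^(gamma T(t))] = E_nu(gamma t^nu). *)

(** * Bounds on the increments of transition probabilities *)

Lemma le_sum_esum (R : realType) (T : choiceType) (s : seq T) (f : T -> \bar R) :
  uniq s -> (\sum_(i <- s) f i <= \esum_(i in [set: T]) f i)%E.
Proof.
move=> us; apply: esum_ge; exists [set` s]; last by rewrite -fsbig_seq.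
by split => //; exact: finite_seq.
Qed.

Section TransitionFunction.
Context {R : realType} {p : int -> int -> R -> R}.
Hypothesis hp : transition_function p.

Lemma trans_ge0 k n t : 0 <= t -> 0 <= p k n t.
Proof. by case: hp => h _ _ _; exact: h. Qed.

Lemma trans_le1 k n t : 0 <= t -> p k n t <= 1.
Proof.
move=> t0; case: hp => _ h _ _; rewrite -lee_fin -(h k t t0).
by rewrite (le_trans _ (@le_sum_esum _ _ [:: n] _ _))// big_seq1.
Qed.

Lemma uniq_neighbours (k : int) : uniq [:: k; k + 1; k - 1].
Proof. by rewrite /= !inE; lia. Qed.

Let nb (F : int -> R) k := F k + F (k + 1) + F (k - 1).

Lemma trans_ge_neighbours k n s t : 0 <= s -> 0 <= t ->
  nb (fun j => p k j s * p j n t) k <= p k n (s + t).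
Proof.
move=> s0 t0; case: hp => _ _ _ /(_ k n s t s0 t0) h.
rewrite -lee_fin -h (le_trans _ (@le_sum_esum _ _ _ _ (uniq_neighbours k)))//.
by rewrite !big_cons big_nil adde0 -!EFinD addrA.
Qed.

Lemma trans_le_neighbours k n s t : 0 <= s -> 0 <= t ->
  p k n (s + t) <=
  nb (fun j => p k j s * p j n t) k + (1 - nb (fun j => p k j s) k).
Proof.
move=> s0 t0.
have p0 j := trans_ge0 k j s0; have q0 j := trans_ge0 j n t0.
have q1 j := trans_le1 j n t0.
case: hp => _ /(_ k s s0) h1 _ /(_ k n s t s0 t0) h.
(* The upper bound is a lower bound for the sum of [p k j s * (1 - p j n t)], which adds up to 1
   with the Chapman-Kolmogorov sum. *)
have := @le_sum_esum _ _ _ (fun j => (p k j s * (1 - p j n t))%:E)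
  (uniq_neighbours k).
have : (\esum_(j in [set: int]) (p k j s * p j n t)%:E +
        \esum_(j in [set: int]) (p k j s * (1 - p j n t))%:E = 1)%E.
  rewrite -h1 -esumD.
  - by apply: eq_esum => j _; rewrite -EFinD; congr (_%:E); ring.
  - by move=> j _; rewrite lee_fin mulr_ge0.
  - by move=> j _; rewrite lee_fin mulr_ge0// subr_ge0.
rewrite h !big_cons big_nil adde0 -!EFinD addrA.
case: (esum _ _) => [r||]//; rewrite -EFinD => -[] e.
by rewrite lee_fin /nb => ?; lra.
Qed.

(** The two neighbour bounds differ by the mass that escapes [k] and its neighbours; divided by [s],
    it is minus the sum of the three rate errors, since the rates [u], [d], [- (u + d)] add up to
    zero. Each error thus counts at most twice. The bound depends on neither [n] nor [t]. *)
Lemma trans_increment_le k n t s (u d : R) : 0 <= t -> 0 < s ->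
  `|(p k n (s + t) - p k n t) / s
     - (u * p (k + 1) n t + d * p (k - 1) n t - (u + d) * p k n t)| <=
  2 * (`|p k (k + 1) s / s - u| + `|p k (k - 1) s / s - d|
       + `|(p k k s - 1) / s + (u + d)|).
Proof.
move=> t0 s0.
have := @trans_ge_neighbours k n s t (ltW s0) t0.
have := @trans_le_neighbours k n s t (ltW s0) t0.
rewrite /nb.
have [a0 a1] := (trans_ge0 (k + 1) n t0, trans_le1 (k + 1) n t0).
have [b0 b1] := (trans_ge0 (k - 1) n t0, trans_le1 (k - 1) n t0).
have [c0 c1] := (trans_ge0 k n t0, trans_le1 k n t0).
move: a0 a1 b0 b1 c0 c1.
set a := p (k + 1) n t; set b := p (k - 1) n t; set c := p k n t.
move=> a0 a1 b0 b1 c0 c1.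
(* In terms of difference quotients, a factor [s] can be cancelled from both bounds. *)
have -> : p k (k + 1) s = s * (p k (k + 1) s / s) by rewrite mulrC divfK// gt_eqF.
have -> : p k (k - 1) s = s * (p k (k - 1) s / s) by rewrite mulrC divfK// gt_eqF.
have -> : p k k s = s * ((p k k s - 1) / s) + 1.
  by rewrite mulrC divfK ?gt_eqF// subrK.
have -> : p k n (s + t) = s * ((p k n (s + t) - c) / s) + c.
  by rewrite mulrC divfK ?gt_eqF// subrK.
rewrite !(addrK, mulrAC s _ s^-1) mulfV ?gt_eqF// !mul1r.
set A := p k (k + 1) s / s; set B := p k (k - 1) s / s.
set C := (p k k s - 1) / s; set D := (_ - c) / s.
move=> hle hge.
have {}hle : D <= C * c + A * a + B * b - (C + A + B) by rewrite -(ler_pM2l s0); lra.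
have {}hge : C * c + A * a + B * b <= D by rewrite -(ler_pM2l s0); lra.
have key (x y : R) : 0 <= y -> y <= 1 -> `|x * y| <= `|x|.
  by move=> y0 y1; rewrite normrM ler_piMr// ger0_norm.
have := key (A - u) a a0 a1; have := key (B - d) b b0 b1.
have := key (C + (u + d)) c c0 c1.
have := ler_norm (A - u); have := ler_norm (- (A - u)).
have := ler_norm (B - d); have := ler_norm (- (B - d)).
have := ler_norm (C + (u + d)); have := ler_norm (- (C + (u + d))).
rewrite !normrN !ler_norml.
set x := `|A - u|; set y := `|B - d|; set v := `|C + (u + d)|.
move=> ? ? ? ? ? ? /andP[? ?] /andP[? ?] /andP[? ?].
by apply/andP; split; lra.
Qed.

(** Staying at [k] during [s] contributes [p k k s * p k n t]; all other moves together have mass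
    [1 - p k k s]. *)
Lemma trans_lipschitz_at k n s t : 0 <= s -> 0 <= t ->
  `|p k n (s + t) - p k n t| <= 1 - p k k s.
Proof.
move=> s0 t0.
have := @trans_ge_neighbours k n s t s0 t0.
have := @trans_le_neighbours k n s t s0 t0.
rewrite /nb.
have [a0 a1] := (trans_ge0 (k + 1) n t0, trans_le1 (k + 1) n t0).
have [b0 b1] := (trans_ge0 (k - 1) n t0, trans_le1 (k - 1) n t0).
have [c0 c1] := (trans_ge0 k n t0, trans_le1 k n t0).
have [? ?] := (trans_ge0 k (k + 1) s0, trans_ge0 k (k - 1) s0).
have ? := trans_le1 k k s0.
by rewrite ler_norml => ? ?; apply/andP; split; nra.
Qed.
End TransitionFunction.

(** * Regularity of the transition probabilities *)

Lemma cvg_at_right0_dist_le (R : realType) (f : R -> R) (l : R) :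
  f s @[s --> 0^'+] --> l ->
  forall e, 0 < e -> exists2 d, 0 < d & forall s, 0 < s -> s < d -> `|f s - l| <= e.
Proof.
move=> /cvgrPdist_le h e e0; have [d /= d0 hd] := h e e0.
exists d => // s s0 sd; rewrite distrC; apply: hd => //=.
by rewrite sub0r normrN gtr0_norm.
Qed.

(** The increment bound [1 - p k k s] is at most a constant times [s] near 0, because the diagonal
    difference quotient converges. The absolute value extends [p k n] evenly to the line, so that
    continuity at 0 is two-sided. *)
Lemma trans_continuous (R : realType) (p : int -> int -> R -> R) (q : R) k n :
  transition_function p -> (p k k s - 1) / s @[s --> 0^'+] --> q ->
  continuous (fun t : R => p k n `|t|).
Proof.
move=> hp hq t; apply/cvgrPdist_le => e e0.
have [d d0 hd] := cvg_at_right0_dist_le hq ltr01.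
(* For [0 < s < d] the diagonal quotient is within 1 of its limit [q]. *)
pose c := 1 + `|q|.
have c0 : 0 < c by rewrite ltr_pwDl.
have hle s : 0 < s -> s < d -> 1 - p k k s <= s * c.
  move=> s0 /(hd _ s0); move=> h.
  have := ler_norm (- ((p k k s - 1) / s - q)).
  have := ler_norm (- q); rewrite !normrN => h1 h2.
  have : - ((p k k s - 1) / s) <= c by rewrite /c; lra.
  by rewrite -mulNr opprB ler_pdivrMr// mulrC.
near=> u.
have lip x y : 0 <= x -> x < y -> y - x < d -> y - x < e / c ->
    `|p k n x - p k n y| <= e.
  move=> x0 xy yxd yxe; rewrite distrC -{1}(subrK x y).
  have yx0 : 0 < y - x by rewrite subr_gt0.
  rewrite (le_trans (trans_lipschitz_at hp _ _ (ltW yx0) x0))//.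
  by rewrite (le_trans (hle _ yx0 yxd))// -ler_pdivlMr// ltW.
have utd : `| `|t| - `|u| | < Num.min d (e / c).
  apply: (le_lt_trans (ler_dist_dist _ _)); near: u.
  by apply: cvgr_dist_lt => //; rewrite lt_min d0 divr_gt0.
move: utd; rewrite lt_min; have [ut|tu|->] := ltgtP `|u| `|t|.
- rewrite gtr0_norm ?subr_gt0// => /andP[? ?].
  by rewrite distrC lip.
- by rewrite ltr0_norm ?subr_lt0// opprB => /andP[? ?]; rewrite lip.
- by rewrite !subrr normr0 (ltW e0).
Unshelve. all: by end_near. Qed.

(** * Birth-death rates and the backward equation *)

Definition bd_generator (R : realType) (up dn u : int -> R) (k : int) : R :=
  up k * u (k + 1) + dn k * u (k - 1) - (up k + dn k) * u k.

Section BirthDeath.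
Context {R : realType} {p : int -> int -> R -> R} {up dn : int -> R}.
Hypothesis hp : transition_function p.
Hypothesis hup : forall k, p k (k + 1) s / s @[s --> 0^'+] --> up k.
Hypothesis hdn : forall k, p k (k - 1) s / s @[s --> 0^'+] --> dn k.
Hypothesis hst : forall k, (p k k s - 1) / s @[s --> 0^'+] --> - (up k + dn k).

(** The threshold [d] serves all [n] and [t] at once; the left derivative needs this, because its
    base point moves. *)
Lemma trans_increment_cvg k e : 0 < e -> exists2 d, 0 < d &
  forall n s t, 0 < s -> s < d -> 0 <= t ->
  `|(p k n (s + t) - p k n t) / s - bd_generator up dn (p ^~ n ^~ t) k| <= e.
Proof.
(* Three rate errors of at most [e / 6], doubled by [trans_increment_le], make [e]. *)
move=> e0; have e6 : 0 < e / 6 by rewrite divr_gt0.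
have [d1 d10 h1] := cvg_at_right0_dist_le (@hup k) e6.
have [d2 d20 h2] := cvg_at_right0_dist_le (@hdn k) e6.
have [d3 d30 h3] := cvg_at_right0_dist_le (@hst k) e6.
exists (Num.min d1 (Num.min d2 d3)); first by rewrite !lt_min d10 d20.
move=> n s t s0; rewrite !lt_min => /and3P[s1 s2 s3] t0.
apply: (le_trans (trans_increment_le hp k n (up k) (dn k) t0 s0)).
have := h1 _ s0 s1; have := h2 _ s0 s2; have := h3 _ s0 s3.
by rewrite opprK => ? ? ?; lra.
Qed.

Lemma bd_generator_continuous n k :
  continuous (fun t : R => bd_generator up dn (p ^~ n ^~ `|t|) k).
Proof.
move=> t; rewrite /bd_generator.
apply: cvgB; [apply: cvgD|]; apply: cvgMr; exact: (trans_continuous hp (@hst _)).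
Qed.

Lemma trans_is_derive (k n : int) (t : R) : 0 < t ->
  is_derive t 1 (fun t : R => p k n `|t|) (bd_generator up dn (p ^~ n ^~ t) k).
Proof.
move=> t0.
suff Hf : h^-1 *: (p k n `|h%:A + t| - p k n `|t|) @[h --> 0^'] -->
    bd_generator up dn (p ^~ n ^~ t) k.
  have F1 : 'D_1 (fun t : R => p k n `|t|) t = bd_generator up dn (p ^~ n ^~ t) k.
    exact: cvg_lim.
  by constructor => //; rewrite /derivable; apply: cvgP Hf.
apply/cvgrPdist_le => e e0.
have e2 : 0 < e / 2 by rewrite divr_gt0.
have [d d0 hd] := trans_increment_cvg k e2.
have ct : bd_generator up dn (p ^~ n ^~ `|h + t|) k @[h --> 0^'] -->
    bd_generator up dn (p ^~ n ^~ t) k.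
  apply: cvg_within_filter.
  have c1 : (h : R) + t @[h --> (0 : R)] --> t.
    by rewrite -{2}[t]add0r; apply: cvgD; [exact: cvg_id|exact: cvg_cst].
  have := cvg_comp _ _ c1 (@bd_generator_continuous n k t).
  by rewrite (gtr0_norm t0).
near=> h.
have h0 : h != 0 by near: h; exact: nbhs_dnbhs_neq.
have ht : `|h| < Num.min d t.
  by near: h; apply: dnbhs0_lt; rewrite lt_min d0.
have cth : `|bd_generator up dn (p ^~ n ^~ t) k - bd_generator up dn (p ^~ n ^~ `|h + t|) k|
    <= e / 2 by near: h; move/cvgrPdist_le: ct; exact.
rewrite lt_min in ht; case/andP: ht => hd' ht.
rewrite [h%:A]mulr1 (gtr0_norm t0) -[_ *: _]/(_ * _) mulrC.
have [hneg|hpos|h00] := ltgtP h 0; last by rewrite h00 eqxx in h0.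
(* A left quotient at [t] is a right quotient at [t + h] with step [- h]; continuity of the
   generator term accounts for the other [e / 2]. *)
- rewrite ltr0_norm// in ht hd'.
  have ht0 : 0 < h + t by lra.
  rewrite (gtr0_norm ht0) in cth *.
  have nh0 : 0 < - h by rewrite oppr_gt0.
  have := hd n _ _ nh0 hd' (ltW ht0).
  rewrite addKr invrN mulrN -mulNr opprB => h1.
  rewrite -(subrKA (bd_generator up dn (p ^~ n ^~ (h + t)) k)).
  rewrite (le_trans (ler_normD _ _))// [leRHS](splitr e) lerD//.
  by rewrite distrC.
- rewrite gtr0_norm// in ht hd'.
  rewrite (gtr0_norm (addr_gt0 hpos t0)).
  rewrite distrC (le_trans (hd n _ _ hpos hd' (ltW t0)))//.
  by rewrite ler_pdivrMr// ler_peMr// ?(ltW e0)// ler1n.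
Unshelve. all: by end_near. Qed.
End BirthDeath.

(** * Uniformization *)

Lemma is_derive1_continuous (R : realType) (f : R -> R) (x df : R) :
  is_derive x 1 f df -> {for x, continuous f}.
Proof.
by move=> [h _]; apply: differentiable_continuous; exact/derivable1_diffP.
Qed.

(** By the mean value theorem [e * f - g] does not increase from 0 to [t], for [e = 1] and for
    [e = -1]. *)
Lemma le_norm_of_derive (R : realType) (f df g dg : R -> R) (t : R) : 0 <= t ->
  continuous f -> continuous g ->
  (forall x, 0 < x < t -> is_derive x 1 f (df x)) ->
  (forall x, 0 < x < t -> is_derive x 1 g (dg x)) ->
  (forall x, 0 < x < t -> `|df x| <= dg x) ->
  `|f 0| <= g 0 -> `|f t| <= g t.
Proof.
move=> t0 cf cg hf hg hle f0.
have key (e : R) (he : `|e| = 1) : e * f t <= g t.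
  pose h x := e * f x - g x.
  have hd x : x \in `]0, t[%R -> is_derive x 1 h (e * df x - dg x).
    rewrite in_itv/= => xt.
    have := hf _ xt; have := hg _ xt => ? ?.
    exact: is_deriveB.
  have hc : {within `[0, t], continuous h}.
    apply: continuous_subspaceT => x.
    by apply: cvgB; [apply: cvgMr; exact: cf|exact: cg].
  have hdle x : 0 < x < t -> e * df x - dg x <= 0.
    move=> /hle xt; rewrite subr_le0 (le_trans (ler_norm _))// normrM he mul1r.
    exact: xt.
  have : h t <= h 0.
    move: (t0); rewrite le_eqVlt => /predU1P[<-//|tpos].
    have [c ct e1] := MVT tpos hd hc.
    rewrite in_itv/= in ct.
    by rewrite -subr_le0 e1 subr0 mulr_le0_ge0 ?hdle.
  have : e * f 0 <= `|f 0| by rewrite (le_trans (ler_norm _))// normrM he mul1r.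
  by rewrite /h; move: f0; lra.
have := key 1 (normr1 _); have := key (-1) (normrN1 _).
by rewrite mul1r mulN1r ler_norml => ? ?; apply/andP; split; lra.
Qed.

Lemma is_derive_exp_coeff (R : realType) (t : R) m :
  is_derive t 1 (fun x : R => exp_coeff x m.+1) (exp_coeff t m).
Proof.
have -> : (fun x : R => exp_coeff x m.+1) =
    (m.+1`!%:R^-1 : R) *: ((fun x : R => x) ^+ m.+1).
  by rewrite exprfctE; apply/funext => x; rewrite /exp_coeff /= mulrC.
apply: is_derive_eq.
rewrite /exp_coeff /= /GRing.scale /= factS natrM.
by rewrite mulr1 invfM mulrACA mulVf ?pnatr_eq0// mul1r mulrC.
Qed.

(** This is [J = G + lam I]; its weights are nonnegative and add up to [lam] once [lam] bounds the
    rates. *)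
Definition bd_jump (R : realType) (lam : R) (up dn u : int -> R) (k : int) : R :=
  up k * u (k + 1) + dn k * u (k - 1) + (lam - up k - dn k) * u k.

(** The entry of [J^m] in row [k] and column [n]. The column index comes first, so that fixing it
    leaves a function of the starting state, on which [J] acts. *)
Definition bd_jumps (R : realType) (lam : R) (up dn : int -> R) (m : nat) (n k : int) : R :=
  iter m (bd_jump lam up dn) (fun j => (j == n)%:R) k.

Arguments bd_jumps : simpl never.

(** The first [M] terms of the Taylor series of [e^(lam t) p_(k,n)(t)] at 0. *)
Definition bd_series (R : realType) (lam : R) (up dn : int -> R) (M : nat)
    (n k : int) (t : R) : R :=
  \sum_(m < M) exp_coeff t m * bd_jumps lam up dn m n k.

Section Uniformization.
Context {R : realType} {p : int -> int -> R -> R} {up dn : int -> R}.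
Hypothesis hp : transition_function p.
Hypothesis hup : forall k, p k (k + 1) s / s @[s --> 0^'+] --> up k.
Hypothesis hdn : forall k, p k (k - 1) s / s @[s --> 0^'+] --> dn k.
Hypothesis hst : forall k, (p k k s - 1) / s @[s --> 0^'+] --> - (up k + dn k).
Variable lam : R.
Hypothesis up_ge0 : forall k, 0 <= up k.
Hypothesis dn_ge0 : forall k, 0 <= dn k.
Hypothesis rate_le : forall k, up k + dn k <= lam.

Local Notation bd_jump := (bd_jump lam up dn).
Local Notation bd_jumps := (bd_jumps lam up dn).
Local Notation bd_series := (bd_series lam up dn).

Lemma bd_jumpE u k : bd_jump u k = bd_generator up dn u k + lam * u k.
Proof. by rewrite /bd_jump /bd_generator; ring. Qed.

Lemma bd_jump_le (u : int -> R) (B : R) k :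
  (forall j, `|u j| <= B) -> `|bd_jump u k| <= lam * B.
Proof.
move=> hu; have := hu (k + 1); have := hu (k - 1); have := hu k.
rewrite /bd_jump !ler_norml.
move: (u k) (u (k + 1)) (u (k - 1)) (up_ge0 k) (dn_ge0 k) (rate_le k).
move=> x y w h1 h2 h3 /andP[? ?] /andP[? ?] /andP[? ?].
by apply/andP; split; nra.
Qed.

Lemma bd_series_sum M n k t :
  bd_jump (bd_series M n ^~ t) k = \sum_(m < M) exp_coeff t m * bd_jumps m.+1 n k.
Proof.
rewrite /bd_series; elim: M => [|M IH].
  by rewrite /bd_jump !big_ord0 !mulr0 !addr0.
rewrite big_ord_recr /= -IH.
have -> : bd_jumps M.+1 n k = bd_jump (bd_jumps M n) k by [].
by rewrite /bd_jump !big_ord_recr /=; ring.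
Qed.

(** Differentiation lowers the index of [exp_coeff], so the partial sums satisfy [r' = J r] up to
    the loss of one term. *)
Lemma is_derive_bd_series (M : nat) (n k : int) (t : R) :
  is_derive t 1 (bd_series M.+1 n k) (bd_jump (bd_series M n ^~ t) k).
Proof.
rewrite bd_series_sum.
elim: M => [|M IH].
  rewrite big_ord0 (_ : bd_series _ _ _ = cst (bd_jumps 0 n k)).
    exact: is_derive_cst.
  apply/funext => x.
  by rewrite /bd_series big_ord_recl big_ord0 /exp_coeff /= expr0 fact0; field.
rewrite big_ord_recr /=.
have -> : bd_series M.+2 n k =
    bd_series M.+1 n k + bd_jumps M.+1 n k *: (fun x => exp_coeff x M.+1).
  by apply/funext => x; rewrite /bd_series big_ord_recr /= mulrC.
rewrite [exp_coeff t M * _]mulrC.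
exact: (is_deriveD IH (is_deriveZ _ (is_derive_exp_coeff t M))).
Qed.

Lemma bd_series0 M n k : bd_series M.+1 n k 0 = (k == n)%:R.
Proof.
rewrite /bd_series big_ord_recl /= big1 ?addr0.
  by rewrite /exp_coeff /= expr0 fact0; field.
by move=> i _; rewrite /exp_coeff /= expr0n !mul0r.
Qed.

Lemma bd_series_continuous (M : nat) (n k : int) : continuous (bd_series M n k).
Proof.
case: M => [t|M t]; last exact: is_derive1_continuous (is_derive_bd_series M n k t).
rewrite (_ : bd_series _ _ _ = cst 0); first exact: cvg_cst.
by apply/funext => x; rewrite /bd_series big_ord0.
Qed.

Lemma rate_bound_ge0 : 0 <= lam.
Proof. by rewrite (le_trans _ (rate_le 0))// addr_ge0. Qed.

(** Induction on [M], for all states at once: by the backward equation the next remainder has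
    derivative [J] applied to the current one, hence at most [lam] times the current bound, and this
    integrates to the next bound. *)
Lemma bd_series_remainder M n k t : 0 <= t ->
  `|expR (lam * t) * p k n t - bd_series M n k t| <=
  expR (lam * t) * exp_coeff (lam * t) M.
Proof.
move=> t0; set C := expR (lam * t).
(* The factor [C] is frozen at the right end of the interval, so that each bound is, up to [lam],
   the derivative of the next. *)
suff : forall k x, 0 <= x <= t ->
    `|expR (lam * x) * p k n `|x| - bd_series M n k x| <= C * exp_coeff (lam * x) M.
  by move=> /(_ k t); rewrite lexx t0 (ger0_norm t0); apply.
have C0 : 0 < C by exact: expR_gt0.
have lam0 := rate_bound_ge0.
elim: M => [|M IH] {}k x /andP[x0 xt].
  rewrite /bd_series big_ord0 subr0 normrM /exp_coeff /= expr0 fact0 divr1.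
  rewrite ger0_norm ?expR_ge0// ler_pM ?expR_ge0//.
    by rewrite ler_expR ler_wpM2l.
  by rewrite !ger0_norm ?(trans_le1 hp)// (trans_ge0 hp).
pose E y := expR (lam * y).
have dE (y : R) : is_derive y 1 E (lam * E y).
  have dl : is_derive y 1 ( *%R lam : R -> R) lam.
    by apply: is_derive_eq; rewrite [LHS]mulr1.
  have := @is_derive1_comp _ expR ( *%R lam) y _ _ (is_derive_expR _) dl.
  by rewrite mulrC.
have dc (y : R) : is_derive y 1 (fun y => exp_coeff (lam * y) M.+1)
    (lam * exp_coeff (lam * y) M).
  have dl : is_derive y 1 ( *%R lam : R -> R) lam.
    by apply: is_derive_eq; rewrite [LHS]mulr1.
  have := is_derive1_comp (is_derive_exp_coeff (lam * y) M) dl.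
  by rewrite mulrC.
apply: (@le_norm_of_derive _ (fun x => E x * p k n `|x| - bd_series M.+1 n k x)
  (fun x => bd_jump (fun j => E x * p j n `|x| - bd_series M n j x) k)
  (fun x => C * exp_coeff (lam * x) M.+1)
  (fun x => C * (lam * exp_coeff (lam * x) M))) => //.
- move=> y; apply: cvgB; last exact: bd_series_continuous.
  apply: cvgM; last exact: (trans_continuous hp (@hst _)).
  exact: is_derive1_continuous (dE y).
- move=> y; apply: cvgMr.
  exact: is_derive1_continuous (dc y).
- move=> y /andP[y0 yx].
  have dp := trans_is_derive hp hup hdn hst k n y0.
  have ds := is_derive_bd_series M n k y.
  have dE' := dE y.
  have -> : bd_jump (fun j => E y * p j n `|y| - bd_series M n j y) k =
      (E y *: bd_generator up dn (p ^~ n ^~ y) k + p k n `|y| *: (lam * E y))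
      - bd_jump (bd_series M n ^~ y) k.
    rewrite (gtr0_norm y0) !bd_jumpE /bd_generator.
    by rewrite /GRing.scale /=; ring.
  exact: (is_deriveB (is_deriveM dE' dp) ds).
- move=> y /andP[y0 yx]; rewrite mulrCA; apply: bd_jump_le => j.
  by apply: IH; rewrite (ltW y0) (le_trans (ltW yx)).
(* At time 0 both terms of the remainder equal the indicator of [k = n]. *)
- rewrite bd_series0 normr0 /E mulr0 expR0 mul1r.
  case: hp => _ _ -> _; rewrite subrr normr0 mulr_ge0 ?(ltW C0)//.
  by rewrite exp_coeff_ge0// mulr0.
Qed.

Lemma bd_series_cvg n k t : 0 <= t ->
  bd_series M n k t @[M --> \oo] --> expR (lam * t) * p k n t.
Proof.
move=> t0.
have c0 : expR (lam * t) * exp_coeff (lam * t) M @[M --> \oo] --> 0.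
  rewrite -(mulr0 (expR (lam * t))); apply: cvgMr; exact: cvg_exp_coeff.
apply/subr_cvg0; apply/norm_cvg0P.
apply: (squeeze_cvgr _ (cvg_cst 0) c0); apply: nearW => M.
by rewrite normr_ge0 distrC bd_series_remainder.
Qed.

Lemma bd_jumps_ge0 m n k : 0 <= bd_jumps m n k.
Proof.
elim: m k => [|m IH] k; first by rewrite /bd_jumps /= ler0n.
rewrite /bd_jumps iterS /bd_jump !addr_ge0// mulr_ge0//; try exact: IH.
by have := rate_le k; lra.
Qed.
End Uniformization.

(** * Generating functions *)

(** One inequality comes from finite sums; the reverse is the same inequality for [c^-1] and the
    family [c * a], the case [c = 0] being apart. *)
Lemma esumZl (R : realType) (T : choiceType) (c : R) (a : T -> \bar R) :
  0 <= c -> (forall i, 0 <= a i)%E ->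
  (\esum_(i in [set: T]) (c%:E * a i) = c%:E * \esum_(i in [set: T]) a i)%E.
Proof.
move=> c0 a0.
have le (d : R) (b : T -> \bar R) : 0 <= d -> (forall i, 0 <= b i)%E ->
    (\esum_(i in [set: T]) (d%:E * b i) <= d%:E * \esum_(i in [set: T]) b i)%E.
  move=> d0 b0; apply: ge_ereal_sup => _ [X [finX XT] <-].
  rewrite -ge0_mule_fsumr// lee_wpmul2l ?lee_fin//.
  by apply: esum_ge; exists X.
apply/eqP; rewrite eq_le le//=.
have [<-|c0n] := eqVneq 0 c.
  by rewrite mul0e esum_ge0// => i _; rewrite mul0e.
have {c0n}c0 : 0 < c by rewrite lt_def eq_sym c0n.
have ci0 : 0 <= c^-1 by rewrite invr_ge0 ltW.
have := le _ (fun i => c%:E * a i)%E ci0 (fun i => mule_ge0 (ltW c0 : (0 <= c%:E)%E) (a0 i)).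
under eq_esum do rewrite muleA -EFinM mulVf ?gt_eqF// mul1e.
move=> h; apply: (le_trans (lee_wpmul2l _ h)); first by rewrite lee_fin ltW.
by rewrite muleA -EFinM divff ?gt_eqF// mul1e.
Qed.

Lemma exchange_esum (R : realType) (T1 T2 : choiceType) (a : T1 -> T2 -> \bar R) :
  (forall i j, 0 <= a i j)%E ->
  (\esum_(i in [set: T1]) \esum_(j in [set: T2]) a i j =
   \esum_(j in [set: T2]) \esum_(i in [set: T1]) a i j)%E.
Proof.
move=> a0; rewrite !esum_esum//.
rewrite (@reindex_esum _ _ _ ([set: T2] `*`` (fun=> [set: T1])) _
  (fun x => (x.2, x.1)))//; split => //=.
  by move=> [i1 i2] [j1 j2] _ _ /= [-> ->].
by move=> [i j] _; exists (j, i).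
Qed.

Section EigenSum.
Context {R : realType} {p : int -> int -> R -> R} {up dn : int -> R}.
Hypothesis hp : transition_function p.
Hypothesis hup : forall k, p k (k + 1) s / s @[s --> 0^'+] --> up k.
Hypothesis hdn : forall k, p k (k - 1) s / s @[s --> 0^'+] --> dn k.
Hypothesis hst : forall k, (p k k s - 1) / s @[s --> 0^'+] --> - (up k + dn k).
Variable lam : R.
Hypothesis up_ge0 : forall k, 0 <= up k.
Hypothesis dn_ge0 : forall k, 0 <= dn k.
Hypothesis rate_le : forall k, up k + dn k <= lam.

Let J0 := bd_jumps_ge0 up_ge0 dn_ge0 rate_le.

(** Nonnegativity of [f] and of the weights lets [J] act under the infinite sum, starting from the
    expansion of [f] in indicators. *)
Lemma bd_jumps_sum (f : int -> R) m k : (forall n, 0 <= f n) ->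
  (\esum_(n in [set: int]) (f n * bd_jumps lam up dn m n k)%:E =
   (iter m (bd_jump lam up dn) f k)%:E)%E.
Proof.
move=> f0; elim: m k => [|m IH] k.
  rewrite (esumID [set k]); last first.
    by move=> n _; rewrite lee_fin mulr_ge0// ler0n.
  rewrite setTI esum_set1; last by rewrite lee_fin mulr_ge0// ler0n.
  rewrite setTI esum1 ?adde0; last first.
    by move=> n /= /eqP/negbTE nk; rewrite /bd_jumps /= eq_sym nk mulr0.
  by rewrite /bd_jumps /= eqxx mulr1.
have nn (c : R) j n : 0 <= c -> (0 <= c%:E * (f n * bd_jumps lam up dn m n j)%:E)%E.
  by move=> c0; rewrite mule_ge0// lee_fin ?mulr_ge0.
have st0 : 0 <= lam - up k - dn k by have := rate_le k; lra.
transitivity (\esum_(n in [set: int])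
   ((up k)%:E * (f n * bd_jumps lam up dn m n (k + 1))%:E
   + (dn k)%:E * (f n * bd_jumps lam up dn m n (k - 1))%:E
   + (lam - up k - dn k)%:E * (f n * bd_jumps lam up dn m n k)%:E))%E.
  apply: eq_esum => n _; rewrite -!EFinM -!EFinD; congr (_%:E).
  by rewrite {1}/bd_jumps iterS {1}/bd_jump /bd_jumps; ring.
rewrite !esumD//; do ?by move=> n _; rewrite ?adde_ge0// nn.
by rewrite !esumZl// ?IH//; do ?by move=> n; rewrite lee_fin mulr_ge0.
Qed.

Lemma trans_jumps_series n k t : 0 <= t ->
  ((expR (lam * t) * p k n t)%:E =
   \esum_(m in [set: nat]) (exp_coeff t m * bd_jumps lam up dn m n k)%:E)%E.
Proof.
move=> t0; rewrite -nneseries_esumT; last first.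
  by move=> m; rewrite lee_fin mulr_ge0 ?exp_coeff_ge0.
apply/esym/cvg_lim => //.
under eq_fun do rewrite sumEFin big_mkord.
apply: cvg_EFin; first exact: nearW.
exact: (bd_series_cvg hp hup hdn hst).
Qed.

(** The operator [J] multiplies [g1] by [lam + h1] and [g2] by [lam + h2], so the series of [J^m f]
    is a combination of two exponentials. Only [f] has a known sign: sums are exchanged for [f], and
    the splitting is done on the real numbers [J^m f]. *)
Lemma trans_eigen_sum (f g1 g2 : int -> R) (h1 h2 : R) k t : 0 <= t ->
  (forall n, 0 <= f n) -> (forall n, f n = g1 n + g2 n) ->
  (forall n, bd_generator up dn g1 n = h1 * g1 n) ->
  (forall n, bd_generator up dn g2 n = h2 * g2 n) ->
  (\esum_(n in [set: int]) (f n * p k n t)%:E =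
   (expR (h1 * t) * g1 k + expR (h2 * t) * g2 k)%:E)%E.
Proof.
move=> t0 f0 fE hg1 hg2.
have iterE m n : iter m (bd_jump lam up dn) f n =
    (lam + h1) ^+ m * g1 n + (lam + h2) ^+ m * g2 n.
  elim: m n => [|m IH] n; first by rewrite /= fE !expr0 !mul1r.
  rewrite iterS /bd_jump !IH !exprS.
  have := hg1 n; have := hg2 n; rewrite /bd_generator.
  move: ((lam + h1) ^+ m) ((lam + h2) ^+ m) => A B e2 e1.
  transitivity (A * (up n * g1 (n + 1) + dn n * g1 (n - 1) -
     (up n + dn n) * g1 n) + B * (up n * g2 (n + 1) + dn n * g2 (n - 1) -
     (up n + dn n) * g2 n) + lam * A * g1 n + lam * B * g2 n); first by ring.
  by rewrite e1 e2; ring.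
have nn m : 0 <= exp_coeff t m by exact: exp_coeff_ge0.
(* The identity is first proved with the factor [expR (lam * t)] that the series for [p] carries. *)
have : (\esum_(n in [set: int]) ((expR (lam * t))%:E * (f n * p k n t)%:E) =
    (expR ((lam + h1) * t) * g1 k + expR ((lam + h2) * t) * g2 k)%:E)%E.
  transitivity (\esum_(n in [set: int]) \esum_(m in [set: nat])
     ((exp_coeff t m)%:E * (f n * bd_jumps lam up dn m n k)%:E))%E.
    apply: eq_esum => n _.
    rewrite -EFinM mulrCA EFinM trans_jumps_series// -esumZl//; last first.
      by move=> m; rewrite lee_fin mulr_ge0.
    by apply: eq_esum => m _; rewrite -!EFinM mulrCA.
  rewrite exchange_esum; last first.
    move=> n m; apply: mule_ge0; rewrite lee_fin; first exact: nn.
    exact: mulr_ge0.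
  transitivity (\esum_(m in [set: nat])
     (exp_coeff t m * iter m (bd_jump lam up dn) f k)%:E)%E.
    apply: eq_esum => m _; rewrite esumZl ?bd_jumps_sum//.
    by move=> n; rewrite lee_fin mulr_ge0.
  rewrite -nneseries_esumT; last first.
    (* By [bd_jumps_sum], [J^m f] is a sum of nonnegative terms. *)
    move=> m; rewrite lee_fin mulr_ge0// -lee_fin -bd_jumps_sum//.
    by apply: esum_ge0 => n _; rewrite lee_fin mulr_ge0.
  apply/cvg_lim => //.
  under eq_fun do rewrite sumEFin.
  apply: cvg_EFin; first exact: nearW.
  suff : (\sum_(0 <= m < N) exp_coeff t m * iter m (bd_jump lam up dn) f k)
      @[N --> \oo] --> expR ((lam + h1) * t) * g1 k + expR ((lam + h2) * t) * g2 k.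
    by [].
  have -> : (fun N => \sum_(0 <= m < N)
        exp_coeff t m * iter m (bd_jump lam up dn) f k) =
      (fun N => series (exp_coeff ((lam + h1) * t)) N * g1 k
                + series (exp_coeff ((lam + h2) * t)) N * g2 k).
    apply/funext => N; rewrite /series /= !mulr_suml -big_split /=.
    apply: eq_bigr => m _; rewrite iterE /exp_coeff /= !exprMn.
    by ring.
  by apply: cvgD; apply: cvgMl; exact: is_cvg_series_exp_coeff.
rewrite esumZl ?expR_ge0//; last first.
  by move=> n; rewrite lee_fin mulr_ge0// (trans_ge0 hp).
rewrite !mulrDl !expRD -!mulrA -mulrDr EFinM.
move=> /(congr1 (fun x => ((expR (lam * t))^-1)%:E * x)%E).
by rewrite !muleA -!EFinM mulVf ?gt_eqF ?expR_gt0// !mul1e mul1r.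
Qed.
End EigenSum.

(** * Eigenvectors for rates that depend on parity *)

(** Here [Z] stands for [z ^ k], while [ca] and [cb] belong to the parity of [k] and to that of its
    neighbours. *)
Lemma parity_eigen (R : realFieldType) (a1 a2 b1 b2 z h e Z : R) :
  z != 0 -> h != 0 -> e ^+ 2 = 1 ->
  h ^+ 2 = (a1 + a2 - (b1 + b2)) ^+ 2 * z ^+ 2 / 4
    + (b1 * z ^+ 2 + b2) * (a1 * z ^+ 2 + a2) ->
  let ca := (b1 + b2 - (a1 + a2)) * z / 2 + a1 * z ^+ 2 + a2 in
  let cb := (a1 + a2 - (b1 + b2)) * z / 2 + b1 * z ^+ 2 + b2 in
  a1 * (Z * z * ((1 + e * (cb / h)) / 2)) + a2 * (Z / z * ((1 + e * (cb / h)) / 2))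
    - (a1 + a2) * (Z * ((1 + e * (ca / h)) / 2)) =
  (- ((a1 + a2 + b1 + b2) / 2) + e * (h / z)) * (Z * ((1 + e * (ca / h)) / 2)).
Proof.
move=> z0 h0 e2 h2 ca cb; apply/eqP; rewrite -subr_eq0; apply/eqP.
(* The difference of the sides is written as a combination of the two relations [e ^ 2 = 1] and the
   value of [h ^ 2]. *)
transitivity (- (Z / (2 * z)) * ((e ^+ 2 - 1) * ca
  + e / h * (h ^+ 2 - ((a1 + a2 - (b1 + b2)) ^+ 2 * z ^+ 2 / 4
    + (b1 * z ^+ 2 + b2) * (a1 * z ^+ 2 + a2))))).
  by rewrite /ca /cb; field; rewrite z0 h0.
by rewrite -h2 e2 !subrr mul0r mulr0 addr0 mulr0.
Qed.

Section AlternatingChain.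
Context {R : realType} {a1 a2 b1 b2 z : R}.
Hypothesis ha1 : 0 < a1.
Hypothesis ha2 : 0 < a2.
Hypothesis hb1 : 0 < b1.
Hypothesis hb2 : 0 < b2.
Hypothesis hz : 0 < z.

Let up (k : int) := if (2 %| k)%Z then a1 else b1.
Let dn (k : int) := if (2 %| k)%Z then a2 else b2.
Let h := hfun a1 a2 b1 b2 z.
Let c (k : int) := cfun a1 a2 b1 b2 k z.

Lemma hfun_gt0 : 0 < h.
Proof.
rewrite /h /hfun mulr_gt0 ?invr_gt0// sqrtr_gt0.
apply: ltr_wpDl; first by rewrite mulr_ge0 ?sqr_ge0.
by rewrite !mulr_gt0 ?addr_gt0 ?mulr_gt0 ?exprn_gt0.
Qed.

Lemma hfun_sqr : h ^+ 2 = (a1 + a2 - (b1 + b2)) ^+ 2 * z ^+ 2 / 4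
  + (b1 * z ^+ 2 + b2) * (a1 * z ^+ 2 + a2).
Proof.
rewrite /h /hfun exprMn sqr_sqrtr; first by field.
apply: addr_ge0; first by rewrite mulr_ge0 ?sqr_ge0.
by rewrite ltW// !mulr_gt0 ?addr_gt0 ?mulr_gt0 ?exprn_gt0.
Qed.

(* The generator maps n |-> z^n x_(n mod 2) to a function of
   the same form, so it acts as a 2x2 matrix with eigenvalues hhat_plus (take
   [e = 1]) and hhat_minus (take [e = -1]). *)
Lemma alternating_eigen (e : R) k : e ^+ 2 = 1 ->
  bd_generator up dn (fun n => z ^ n * ((1 + e * (c n / h)) / 2)) k =
  (- ((a1 + a2 + b1 + b2) / 2) + e * (h / z)) *
    (z ^ k * ((1 + e * (c k / h)) / 2)).
Proof.
move=> e2; have z0 : z != 0 by rewrite gt_eqF.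
have h0 : h != 0 by rewrite gt_eqF// hfun_gt0.
have pD : (2 %| k + 1)%Z = ~~ (2 %| k)%Z by lia.
have pB : (2 %| k - 1)%Z = ~~ (2 %| k)%Z by lia.
rewrite /bd_generator /up /dn /c /cfun pD pB !expfzDr// expr1z exprN1.
have h2 := hfun_sqr.
move: (z ^ k) => Z.
case: (2 %| k)%Z => /=; first exact: parity_eigen.
(* For odd [k] the pairs of rates trade places; [h ^ 2] and the sum of the rates are symmetric in
   them. *)
have -> : a1 + a2 + b1 + b2 = b1 + b2 + a1 + a2 by ring.
apply: parity_eigen => //; rewrite h2 -[b1 + b2 - _]opprB sqrrN.
by congr (_ + _); rewrite mulrC.
Qed.

Context {p : int -> int -> R -> R}.
Hypothesis hp : transition_function p.
Hypothesis hg : has_generator p (alternating_generator a1 a2 b1 b2).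

Lemma alternating_pgf k t : 0 <= t ->
  (\esum_(n in [set: int]) (z ^ n * p k n t)%:E =
   (expR (hhat_plus a1 a2 b1 b2 z * t) * (z ^ k * ((1 + c k / h) / 2))
    + expR (hhat_minus a1 a2 b1 b2 z * t) * (z ^ k * ((1 - c k / h) / 2)))%:E)%E.
Proof.
move=> t0; case: (hp) => _ _ p0 _.
have up0 j : 0 < up j by rewrite /up; case: ifP.
have dn0 j : 0 < dn j by rewrite /dn; case: ifP.
have hup j : p j (j + 1) s / s @[s --> 0^'+] --> up j.
  have := @hg j (j + 1); rewrite /alternating_generator eqxx p0.
  rewrite (_ : (j == j + 1) = false); last by lia.
  by under eq_fun do rewrite subr0.
have hdn j : p j (j - 1) s / s @[s --> 0^'+] --> dn j.
  have := @hg j (j - 1); rewrite /alternating_generator eqxx p0.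
  rewrite (_ : (j - 1 == j + 1) = false); last by lia.
  rewrite (_ : (j == j - 1) = false); last by lia.
  by under eq_fun do rewrite subr0.
have hst j : (p j j s - 1) / s @[s --> 0^'+] --> - (up j + dn j).
  have := @hg j j; rewrite /alternating_generator eqxx p0 eqxx.
  rewrite (_ : (j == j + 1) = false); last by lia.
  by rewrite (_ : (j == j - 1) = false); last by lia.
(* The sum of all four rates bounds the total rate at either parity; [z ^ n] splits into the
   eigenvectors for [e = 1] and [e = -1]. *)
apply: (@trans_eigen_sum _ _ up dn hp hup hdn hst (a1 + a2 + b1 + b2) _ _ _
  (fun n => z ^ n) (fun n => z ^ n * ((1 + c n / h) / 2))
  (fun n => z ^ n * ((1 - c n / h) / 2))) => //.
- by move=> j; exact: ltW.
- by move=> j; exact: ltW.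
- move=> j; rewrite /up /dn -[leRHS]addrA.
  by case: ifP => _; rewrite ?lerDl ?lerDr addr_ge0// ltW.
- by move=> n; rewrite exprz_ge0// ltW.
- by move=> n; field; rewrite gt_eqF// hfun_gt0.
- move=> n; have := @alternating_eigen 1 n (expr1n _ _).
  rewrite /hhat_plus mul1r.
  by under [X in bd_generator _ _ X]eq_fun do rewrite mul1r; rewrite mul1r.
- move=> n; have := @alternating_eigen (-1) n (sqrr_sign _ 1).
  rewrite /hhat_minus mulN1r.
  by under [X in bd_generator _ _ X]eq_fun do rewrite mulN1r; rewrite mulN1r.
Qed.
End AlternatingChain.

(** * Events at an independent random time *)

(** Strictly above [x] even at grid points, so that [x] is approached from the right; constant on
    each [grid_cell]. *)
Definition grid_above (R : realType) (m : nat) (x : R) : R :=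
  (Num.truncn (m.+1%:R * x)).+1%:R / m.+1%:R.

Definition grid_cell (R : realType) (m j : nat) : set R :=
  `[(j%:R / m.+1%:R)%R, (j.+1%:R / m.+1%:R)%R[%classic.

Lemma in_grid_cell (R : realType) (m j : nat) (x : R) : 0 <= x ->
  grid_cell m j x <-> Num.truncn (m.+1%:R * x) = j.
Proof.
move=> x0; rewrite /grid_cell /= in_itv /= ler_pdivrMr// ltr_pdivlMr//.
rewrite ![x * _]mulrC -truncn_eq ?mulr_ge0//.
by split => /eqP.
Qed.

Lemma grid_above_gt (R : realType) (m : nat) (x : R) : x < grid_above m x.
Proof. by rewrite /grid_above ltr_pdivlMr// mulrC truncnS_gt. Qed.

Lemma grid_above_cvg (R : realType) (x : R) : 0 <= x ->
  grid_above m x @[m --> \oo] --> x.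
Proof.
move=> x0.
have h : x + m.+1%:R^-1 @[m --> \oo] --> x.
  rewrite -[X in _ --> X]addr0; apply: cvgD; first exact: cvg_cst.
  exact: cvg_harmonic.
apply: (squeeze_cvgr _ (cvg_cst x) h); apply: nearW => m.
rewrite (ltW (grid_above_gt _ _)) /= /grid_above ler_pdivrMr//.
rewrite mulrDl mulVf// -natr1 lerD2r mulrC truncn_le mulr_ge0//.
Qed.

Lemma near_grid_above (R : realType) (x : R) (Q : set R) : 0 <= x ->
  (\forall u \near x^'+, Q u) -> \forall m \near \oo, Q (grid_above m x).
Proof.
move=> x0 hQ.
have : \forall m \near \oo, x < grid_above m x -> Q (grid_above m x).
  exact: (grid_above_cvg x0 hQ).
by apply: filterS => m; apply; exact: grid_above_gt.
Qed.

Section RandomTime.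
Context {R : realType} {d : measure_display} {Omega : measurableType d}.
Variables (E : R -> set Omega) (tau : Omega -> R).
Hypothesis mE : forall s, 0 <= s -> measurable (E s).
Hypothesis rE : forall w s, 0 <= s -> \forall u \near s^'+, E u w = E s w.
Hypothesis mtau : measurable_fun [set: Omega] tau.
Hypothesis tau0 : forall w, 0 <= tau w.

Let slot m j := tau @^-1` grid_cell m j.

Let mslot m j : measurable (slot m j).
Proof.
by rewrite -[slot m j]setTI; apply: mtau => //; exact: measurable_itv.
Qed.

Let slotP m j w : slot m j w <-> Num.truncn (m.+1%:R * tau w) = j.
Proof. exact: in_grid_cell. Qed.

Let trivIset_slot m : trivIset setT (slot m).
Proof.
apply/trivIsetP => i j _ _ ij; apply/seteqP; split => // w [/slotP ei /slotP ej].
by move: ij; rewrite -ei -ej eqxx.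
Qed.

Let cover_slot m : \bigcup_j slot m j = setT.
Proof.
by apply/seteqP; split => // w _; exists (Num.truncn (m.+1%:R * tau w)) => //; apply/slotP.
Qed.

Let grid m j : R := j.+1%:R / m.+1%:R.

Let grid0 m j : 0 <= grid m j. Proof. by rewrite divr_ge0. Qed.

Let Em m := [set w | E (grid_above m (tau w)) w].

(** On a slot the rounded time is the fixed time [grid m j]. *)
Let EmE m : Em m = \bigcup_j (E (grid m j) `&` slot m j).
Proof.
apply/seteqP; split => w.
  by move=> h; exists (Num.truncn (m.+1%:R * tau w)) => //; split => //; apply/slotP.
by case=> j _ [h /slotP e]; rewrite /Em /= /grid_above e.
Qed.

Let mEm m : measurable (Em m).
Proof.
by rewrite EmE; apply: bigcupT_measurable => j; apply: measurableI => //; exact: mE.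
Qed.

Let Em_cvg w : \1_(Em m) w @[m --> \oo] --> (\1_[set w | E (tau w) w] w : R).
Proof.
apply: cvg_near_cst.
have := near_grid_above (tau0 w) (rE w (tau0 w)).
apply: filterS => m h; rewrite !indicE; congr (_%:R); congr (nat_of_bool _).
by apply/idP/idP; rewrite !inE /= /Em /= h.
Qed.

(** By right continuity the indicators of the rounded events [Em m] are eventually constant at each
    [w], with the wanted indicator as limit. *)
Lemma random_time_measurable : measurable [set w | E (tau w) w].
Proof.
have mf : measurable_fun [set: Omega] (\1_[set w | E (tau w) w] : Omega -> R).
  apply: (measurable_fun_cvg (h := fun m => \1_(Em m))) => [m|w _].
    exact: measurable_indic.
  exact: Em_cvg.
have -> : [set w | E (tau w) w] = \1_[set w | E (tau w) w] @^-1` [set (1 : R)].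
  apply/seteqP; split => w /=; rewrite indicE; first by move=> ?; rewrite mem_set.
  case: (boolP (w \in _)) => [|_ /eqP]; first by rewrite inE.
  by rewrite eq_sym oner_eq0.
by rewrite -[X in measurable X]setTI; exact: mf.
Qed.

Context (P : probability Omega R) (g : R -> R).
Hypothesis gP : forall s, 0 <= s -> P (E s) = (g s)%:E.
Hypothesis g_continuous : continuous (fun s : R => g `|s|).
Hypothesis E_indep : forall s (B : set R), 0 <= s -> measurable B ->
  P (E s `&` tau @^-1` B) = (P (E s) * P (tau @^-1` B))%E.

Let g01 s : 0 <= s -> 0 <= g s <= 1.
Proof.
by move=> s0; rewrite -!lee_fin -gP// measure_ge0 probability_le1//; exact: mE.
Qed.

Let mg : measurable_fun [set: Omega] (fun w => g (tau w)).
Proof.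
have -> : (fun w => g (tau w)) = (fun s : R => g `|s|) \o tau.
  by apply/funext => w /=; rewrite ger0_norm.
by apply: measurableT_comp => //; exact: continuous_measurable_fun.
Qed.

Let mgm m : measurable_fun [set: Omega] (fun w => g (grid_above m (tau w))).
Proof.
rewrite -(cover_slot m); apply/measurable_fun_bigcup => // j.
apply: (eq_measurable_fun (cst (g (grid m j)))); last exact: measurable_cst.
by move=> w /set_mem /slotP e; rewrite /= /grid_above e.
Qed.

(** On each slot independence factors the probability at a fixed time; the sum over slots is the
    integral of a step function. *)
Let grid_integral m :
  P (Em m) = (\int[P]_w (g (grid_above m (tau w)))%:E)%E.
Proof.
have ga0 w : 0 <= grid_above m (tau w) by exact: grid0.
rewrite -[in RHS](cover_slot m) ge0_integral_bigcup//; last 2 first.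
- by rewrite cover_slot; apply/measurable_EFinP.
- by move=> w _; rewrite lee_fin; have /andP[] := g01 (ga0 w).
rewrite EmE measure_semi_bigcup//; last 3 first.
- by move=> j; apply: measurableI => //; exact: mE.
- apply/trivIsetP => i j _ _ ij; rewrite setIACA.
  by move/trivIsetP: (@trivIset_slot m) => ->//; rewrite setI0.
- by rewrite -EmE.
apply: eq_eseriesr => j _.
rewrite (eq_integral (fun=> (g (grid m j))%:E)); last first.
  by move=> w /set_mem /slotP e; rewrite /= /grid_above e.
rewrite integral_cst// -gP//; apply: E_indep => //.
exact: measurable_itv.
Qed.

(* Rounding tau up to a grid gives a time with countably many values, where
   independence applies; right continuity of E removes the rounding. *)
Lemma random_time_probability :
  P [set w | E (tau w) w] = (\int[P]_w (g (tau w))%:E)%E.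
Proof.
have i1 : P.-integrable [set: Omega] (EFin \o cst 1%R).
  exact: finite_measure_integrable_cst.
have c1 : P (Em m) @[m --> \oo] --> P [set w | E (tau w) w].
  have indicE' A : measurable A -> P A = (\int[P]_w (\1_A w)%:E)%E.
    by move=> mA; rewrite integral_indic// setIT.
  rewrite (indicE' _ random_time_measurable).
  under eq_fun do rewrite indicE'//.
  apply: (@dominated_cvg _ _ _ P _ measurableT (fun m w => (\1_(Em m) w)%:E)
    (fun w => (\1_[set w | E (tau w) w] w)%:E) (EFin \o cst 1%R)) => //.
  - by move=> m; apply/measurable_EFinP; exact: measurable_indic.
  - by move=> w _; apply: cvg_EFin; [exact: nearW|exact: Em_cvg].
  - by move=> m w _ /=; rewrite lee_fin indicE normr_nat lern1 leq_b1.
(* The same sequence has a second limit, through continuity of [g]; both limits use dominated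
   convergence with bound 1. *)
have c2 : P (Em m) @[m --> \oo] --> (\int[P]_w (g (tau w))%:E)%E.
  under eq_fun do rewrite grid_integral.
  apply: (@dominated_cvg _ _ _ P _ measurableT
    (fun m w => (g (grid_above m (tau w)))%:E) (fun w => (g (tau w))%:E)
    (EFin \o cst 1%R)) => //.
  - by move=> m; apply/measurable_EFinP.
  - move=> w _; apply: cvg_EFin; first exact: nearW.
    have := cvg_comp _ _ (grid_above_cvg (tau0 w)) (@g_continuous (tau w)).
    rewrite (ger0_norm (tau0 w)) => h.
    apply: cvg_trans h; apply: near_eq_cvg; apply: nearW => m /=.
    by rewrite ger0_norm// grid0.
  - move=> m w _ /=; rewrite lee_fin.
    have /andP[g0 g1] := g01 (grid0 m (Num.truncn (m.+1%:R * tau w))).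
    by rewrite ger0_norm.
exact: (cvg_unique _ c1 c2).
Qed.
End RandomTime.

(** * The inverse subordinator *)

Section InverseSubordinator.
Context {R : realType} {d : measure_display} {Omega : measurableType d}.
Variable S : R -> Omega -> R.
Hypothesis mS : forall s, 0 <= s -> measurable_fun [set: Omega] (S s).
Hypothesis S_mono : forall w s u, 0 <= s -> s <= u -> S s w <= S u w.

Lemma inverse_subordinator_ge0 t w : 0 <= inverse_subordinator S t w.
Proof.
rewrite /inverse_subordinator; set A := [set s | _].
have [A0|A0] := pselect (A !=set0); first by apply: lb_le_inf => // s [].
by rewrite inf_out// => -[].
Qed.

(** Monotone paths reduce the infimum to rational times, which makes the event a countable
    combination. The first alternative is the path that never exceeds [t], where the infimum of the
    empty set is 0, hence below [x]. *)
Lemma inverse_subordinator_lt t w x : 0 < x ->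
  inverse_subordinator S t w < x <->
  (forall n : nat, S n%:R w <= t) \/
  (exists q : rat, 0 <= (ratr q : R) < x /\ t < S (ratr q) w).
Proof.
move=> x0; rewrite /inverse_subordinator; set A := [set s | _].
split.
- have [A0|A0] := pselect (A !=set0).
    move=> /(inf_lt A0)[s [s0 ts] sx]; right.
    have [q] := rat_in_itvoo sx; rewrite in_itv/= => /andP[/ltW sq qx].
    exists q; rewrite qx (le_trans s0 sq); split => //.
    exact: lt_le_trans (S_mono _ s0 sq).
  by move=> _; left => n; rewrite leNgt; apply/negP => h; apply: A0; exists n%:R.
- case=> [h|[q [/andP[q0 qx] tq]]].
    (* A time [s] with value above [t] would force a larger integer time to exceed [t] too. *)
    rewrite inf_out// => -[[s [s0 ts]] _].
    move: ts; rewrite ltNge => /negP; apply.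
    exact: le_trans (S_mono _ s0 (ltW (truncnS_gt s))) (h _).
  apply: le_lt_trans qx; apply: ge_inf; last by split.
  by exists 0 => s [].
Qed.

Lemma inverse_subordinator_measurable t :
  measurable_fun [set: Omega] (inverse_subordinator S t).
Proof.
apply: (measurability _ (RGenInftyO.measurableE R)) => //.
move=> _ [_ [x ->] <-]; rewrite setTI.
have [x0|x0] := leP x 0.
  rewrite (_ : _ @^-1` _ = set0); first exact: measurable0.
  apply/seteqP; split => // w /=; rewrite in_itv/= ltNge.
  by rewrite (le_trans x0)// inverse_subordinator_ge0.
have -> : inverse_subordinator S t @^-1` `]-oo, x[ =
    (\bigcap_(n : nat) (S n%:R @^-1` `]-oo, t])) `|`
    \bigcup_(q : rat) (if 0 <= (ratr q : R) < x
                       then S (ratr q) @^-1` `]t, +oo[ else set0).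
  apply/seteqP; split => w /=; rewrite in_itv/= inverse_subordinator_lt//.
    case=> [h|[q [qx tq]]]; [left => n _ /=|right; exists q => //].
      by rewrite in_itv/=.
    by rewrite qx /= in_itv/= tq.
  case=> [h|[q _]]; first by left => n; have := h n I; rewrite /= in_itv.
  case: ifP => // qx; rewrite /= in_itv/= andbT => tq.
  by right; exists q.
apply: measurableU.
  apply: bigcapT_measurable => n; rewrite -[X in measurable X]setTI.
  by apply: mS => //; exact: measurable_itv.
apply: bigcupT_measurable_rat => q; case: ifP => [/andP[q0 _]|_].
  by rewrite -[X in measurable X]setTI; apply: mS => //; exact: measurable_itv.
exact: measurable0.
Qed.
End InverseSubordinator.

(** * Sums over the integers under an integral *)

(** Even numbers enumerate the nonnegative integers and odd ones the negative integers, turning sums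
    over [int] into series. *)
Definition int_of_nat (n : nat) : int :=
  if odd n then Negz n./2 else Posz n./2.

Lemma int_of_nat_bij : set_bij [set: nat] [set: int] int_of_nat.
Proof.
split => //.
- move=> m n _ _; rewrite /int_of_nat.
  have := odd_double_half m; have := odd_double_half n.
  by case: (odd m); case: (odd n) => /= en em e; rewrite -em -en; lia.
- move=> [n|n] _.
    by exists n.*2 => //; rewrite /int_of_nat odd_double doubleK.
  exists n.*2.+1 => //.
  by rewrite /int_of_nat /= odd_double /= uphalf_double.
Qed.

Lemma integral_esum_int (R : realType) (d : measure_display)
    (T : measurableType d) (mu : {measure set T -> \bar R})
    (f : int -> T -> \bar R) :
  (forall n, measurable_fun [set: T] (f n)) -> (forall n x, 0 <= f n x)%E ->
  (\int[mu]_x (\esum_(n in [set: int]) f n x) =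
   \esum_(n in [set: int]) (\int[mu]_x f n x))%E.
Proof.
move=> mf f0.
rewrite (reindex_esum [set: nat] _ _ _ int_of_nat_bij) -nneseries_esumT; last first.
  by move=> n; apply: integral_ge0 => x _.
rewrite -integral_nneseries//.
apply: eq_integral => x _.
by rewrite (reindex_esum [set: nat] _ _ _ int_of_nat_bij) -nneseries_esumT.
Qed.

(** * The time-changed chain *)

Lemma probability_ae_eq (R : realType) (d : measure_display)
    (Omega : measurableType d) (P : probability Omega R) (A B : set Omega) :
  measurable A -> measurable B -> {ae P, forall w, A w = B w} -> P A = P B.
Proof.
move=> mA mB [N [mN PN0 AB]].
have le (C D : set Omega) : measurable C -> measurable D ->
    (forall w, ~ N w -> C w = D w) -> (P C <= P D)%E.
  move=> mC mD CD.
  apply: (@le_trans _ _ (P (D `|` N))); last first.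
    have := measureU2 P mD mN.
    by rewrite [X in (_ <= _ + X)%E](_ : _ = 0%E) ?adde0//; exact: PN0.
  apply: le_measure; rewrite ?inE//; first exact: measurableU.
  by move=> w Cw; have [Nw|Nw] := pselect (N w); [right|left; rewrite -CD].
have e w : ~ N w -> A w = B w by move=> Nw; apply: contrapT => /AB.
by apply/eqP; rewrite eq_le !le// => w /e.
Qed.

Lemma integral_int_valued (R : realType) (d : measure_display)
    (Omega : measurableType d) (P : probability Omega R) (D : set Omega)
    (Y : Omega -> int) (f : int -> R) :
  measurable D -> (forall n, measurable (Y @^-1` [set n])) ->
  (forall n, 0 <= f n) ->
  (\int[P]_(w in D) (f (Y w))%:E =
   \esum_(n in [set: int]) ((f n)%:E * P (D `&` Y @^-1` [set n])))%E.
Proof.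
move=> mD mY f0; rewrite integral_mkcond.
transitivity (\int[P]_w (\esum_(n in [set: int])
    ((f n)%:E * (\1_(D `&` Y @^-1` [set n]) w)%:E)))%E.
  apply: eq_integral => w _.
  (* Only the term [n = Y w] can be nonzero. *)
  rewrite (esumID [set Y w]); last first.
    by move=> n _; rewrite mule_ge0// lee_fin.
  rewrite setTI esum_set1; last by rewrite mule_ge0// lee_fin.
  rewrite setTI esum1 ?adde0; last first.
    move=> n /= nY; rewrite indicE memNset ?mule0// => -[_ /= e].
    by apply: nY; rewrite e.
  rewrite /patch indicE in_setI [w \in Y @^-1` _]mem_set// andbT.
  by case: ifP => _; rewrite ?mule1 ?mule0.
rewrite integral_esum_int.
- apply: eq_esum => n _.
  rewrite ge0_integralZl_EFin//.
  + by rewrite integral_indic ?setIT//; exact: measurableI.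
  + by apply/measurable_EFinP; apply: measurable_indic; exact: measurableI.
- move=> n; apply: measurable_funeM; apply/measurable_EFinP.
  by apply: measurable_indic; exact: measurableI.
- by move=> n w; rewrite mule_ge0// lee_fin.
Qed.

Section TimeChange.
Context {R : realType} {d : measure_display} {Omega : measurableType d}.
Variables (P : probability Omega R) (p : int -> int -> R -> R).
Variables (g : int -> int -> R) (X : R -> Omega -> int).
Hypothesis hp : transition_function p.
Hypothesis hg : has_generator p g.
Hypothesis hX : markov_chain P X p.

Lemma chain_event_probability k n s : 0 <= s ->
  P (X 0 @^-1` [set k] `&` X s @^-1` [set n]) =
  (P (X 0 @^-1` [set k]) * (p k n s)%:E)%E.
Proof.
move=> s0; case: hX => _ _.
move=> /(_ 0%N (fun=> 0) (fun=> k) s n (lexx _)).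
have -> : [set w | forall i, (i <= 0)%N -> X 0 w = k] = X 0 @^-1` [set k].
  by apply/seteqP; split => w /= h; [exact: (h 0%N)|move=> i _].
by rewrite subr0; apply.
Qed.

Lemma time_changed_measurable (tau : Omega -> R) n :
  measurable_fun [set: Omega] tau -> (forall w, 0 <= tau w) ->
  measurable [set w | X (tau w) w = n].
Proof.
case: hX => mX rX _ mtau tau0.
apply: (@random_time_measurable _ _ _ (fun s => X s @^-1` [set n])) => //.
- by move=> s s0; exact: mX.
- move=> w s s0; apply: filterS (rX w s s0) => u /= e.
  by rewrite e.
Qed.

(** The random time is inserted into the joint event of [X 0 = k] and [X s = n], whose probability
    at fixed [s] is the integrand by the Markov property. *)
Lemma time_changed_law (tau : Omega -> R) k n :
  measurable_fun [set: Omega] tau -> (forall w, 0 <= tau w) ->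
  (forall s B, 0 <= s -> measurable B ->
     P ((X 0 @^-1` [set k] `&` X s @^-1` [set n]) `&` tau @^-1` B) =
     (P (X 0 @^-1` [set k] `&` X s @^-1` [set n]) * P (tau @^-1` B))%E) ->
  P (X 0 @^-1` [set k] `&` [set w | X (tau w) w = n]) =
  (\int[P]_w (fine (P (X 0 @^-1` [set k])) * p k n (tau w))%:E)%E.
Proof.
move=> mtau tau0 ind; case: (hX) => mX rX _.
have mA : measurable (X 0 @^-1` [set k]) by exact: mX.
apply: (@random_time_probability _ _ _
  (fun s => X 0 @^-1` [set k] `&` X s @^-1` [set n]) tau _ _ _ _ P
  (fun s => fine (P (X 0 @^-1` [set k])) * p k n s)) => //.
- by move=> s s0; apply: measurableI => //; exact: mX.
- move=> w s s0; apply: filterS (rX w s s0) => u /= e.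
  by rewrite e.
- move=> s s0; rewrite chain_event_probability// EFinM fineK//.
  exact: fin_num_measure.
- move=> s; apply: cvgMr; apply: (@trans_continuous _ _ (g k k) _ _ hp).
  have := @hg k k; case: (hp) => _ _ -> _; rewrite eqxx; exact.
Qed.
End TimeChange.

(** Brings the joint event of [X 0] and [X s] within reach of the independence of the two
    processes. *)
Lemma process_events_setI (R : realType) (d : measure_display)
    (Omega : measurableType d) (E : Type) (M : set (set E))
    (Y : R -> Omega -> E) (A B : set Omega) :
  process_events M Y A -> process_events M Y B -> process_events M Y (A `&` B).
Proof.
exact: (@measurableI _ (g_sigma_algebraType
  [set A | exists2 t : R, 0 <= t & exists2 B, M B & A = Y t @^-1` B])).
Qed.

Theorem proposition4p1 (R : realType) (d : measure_display)
    (Omega : measurableType d) (P : probability Omega R)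
    (a1 a2 b1 b2 nu : R)
    (ha1 : 0 < a1) (ha2 : 0 < a2) (hb1 : 0 < b1) (hb2 : 0 < b2)
    (hnu0 : 0 < nu) (hnu1 : nu < 1)
    (p : int -> int -> R -> R) (X : R -> Omega -> int)
    (hp : transition_function p)
    (hg : has_generator p (alternating_generator a1 a2 b1 b2))
    (hX : markov_chain P X p)
    (S : R -> Omega -> R) (hS : stable_subordinator P nu S)
    (T : R -> Omega -> R) (hT : T = inverse_subordinator S)
    (hT0 : {ae P, forall w, T 0 w = 0})
    (hTL : forall gamma t : R, 0 <= t ->
       ('E_P[fun w => expR (gamma * T t w)]
         = (mittag_leffler nu (gamma * t `^ nu))%:E)%E)
    (hXT : independent_families P
       (process_events (@setT (set int)) X)
       (process_events (@measurable _ (measurableTypeR R)) T))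
    (Xnu : R -> Omega -> int) (hXnu : Xnu = fun t w => X (T t w) w)
    (k : int) (hk : (0 < P (Xnu 0%R @^-1` [set k]))%E)
    (z t : R) (hz : 0 < z) (ht : 0 <= t) :
  let start := Xnu 0 @^-1` [set k] in
  let Eplus := mittag_leffler nu (hhat_plus a1 a2 b1 b2 z * t `^ nu) in
  let Eminus := mittag_leffler nu (hhat_minus a1 a2 b1 b2 z * t `^ nu) in
  let F := z ^ k * ((Eminus + Eplus) / 2
             + cfun a1 a2 b1 b2 k z / hfun a1 a2 b1 b2 z
               * ((Eplus - Eminus) / 2)) in
  cond_expectation P start (fun w => z ^ Xnu t w) = F%:E /\
  (\esum_(n in [set: int])
      (z ^ n * cond_prob P start (Xnu t @^-1` [set n]))%:E = F%:E)%E.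
Proof.
move=> start Eplus Eminus F.
case: (hX) => mX _ _; case: (hS) => mS pathS _ _ _.
have Smono w s u : 0 <= s -> s <= u -> S s w <= S u w.
  by case: (pathS w) => _ + _; exact.
have mT s : measurable_fun [set: Omega] (T s).
  by rewrite hT; exact: inverse_subordinator_measurable.
have T_ge0 s w : 0 <= T s w by rewrite hT; exact: inverse_subordinator_ge0.
pose A := X 0 @^-1` [set k].
have mA : measurable A by exact: mX.
have mXnu s n : measurable (Xnu s @^-1` [set n]).
  by rewrite hXnu; exact: (time_changed_measurable hX).
have mstart : measurable start by exact: mXnu.
(* As [T 0 = 0] almost surely, [start] and the event [X 0 = k] differ by a null set. *)
have startA C : measurable C -> P (start `&` C) = P (A `&` C).
  move=> mC; apply: probability_ae_eq; [exact: measurableI..|].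
  apply: filterS hT0 => w Tw.
  by rewrite /start /A hXnu /setI /mkset /preimage /= Tw.
have PA : P start = P A by have := startA _ measurableT; rewrite !setIT.
pose c := fine (P A).
have cE : P A = c%:E by rewrite fineK// fin_num_measure.
have c0 : 0 < c by rewrite -lte_fin -cE -PA.
have law n : P (start `&` Xnu t @^-1` [set n]) =
    (\int[P]_w (c * p k n (T t w))%:E)%E.
  rewrite startA// hXnu.
  apply: (time_changed_law hp hg hX) => // s B s0 mB.
  apply: hXT.
    apply: process_events_setI; apply: sub_sigma_algebra.
      by exists 0 => //; exists [set k].
    by exists s => //; exists [set n].
  by apply: sub_sigma_algebra; exists t => //; exists B.
have mexp (gamma : R) : measurable_fun [set: Omega] (fun w => expR (gamma * T t w)).
  by apply: measurableT_comp => //; apply: measurable_funM.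
(* The exponent [gamma] may be positive, so integrability is read off from the finite value in
   [hTL]. *)
have iexp (gamma : R) : P.-integrable [set: Omega] (fun w => (expR (gamma * T t w))%:E).
  apply/integrableP; split; first exact/measurable_EFinP.
  under eq_integral do rewrite gee0_abs ?lee_fin ?expR_ge0//.
  by have := hTL gamma t ht; rewrite unlock => ->; rewrite ltry.
have mpk n : measurable_fun [set: Omega] (fun w => p k n (T t w)).
  have -> : (fun w => p k n (T t w)) = (fun s : R => p k n `|s|) \o T t.
    by apply/funext => w /=; rewrite ger0_norm.
  apply: measurableT_comp => //; apply: continuous_measurable_fun.
  apply: (@trans_continuous _ _ (alternating_generator a1 a2 b1 b2 k k) _ _ hp).
  by have := hg k k; case: (hp) => _ _ -> _; rewrite eqxx; exact.
(* This is the generating function before division by [c], the probability of [start]; both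
   conclusions follow from it. *)
have key : (\esum_(n in [set: int])
    ((z ^ n)%:E * P (start `&` Xnu t @^-1` [set n])) = (c * F)%:E)%E.
  transitivity (\esum_(n in [set: int])
      (\int[P]_w (c%:E * (z ^ n * p k n (T t w))%:E)))%E.
    apply: eq_esum => n _; rewrite law -ge0_integralZl_EFin//.
    - by apply: eq_integral => w _; rewrite -!EFinM mulrCA.
    - by move=> w _; rewrite lee_fin mulr_ge0 ?(ltW c0)// (trans_ge0 hp).
    - by apply/measurable_EFinP; apply: measurable_funM.
    - by rewrite exprz_ge0// ltW.
  rewrite -integral_esum_int; last 2 first.
  - move=> n; apply: measurable_funeM; apply/measurable_EFinP.
    by apply: measurable_funM.
  - move=> n w; rewrite mule_ge0 ?lee_fin ?(ltW c0)// mulr_ge0 ?(trans_ge0 hp)//.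
    by rewrite exprz_ge0// ltW.
  have G w := alternating_pgf ha1 ha2 hb1 hb2 hz hp hg k (T_ge0 t w).
  (* The coefficients of the two exponentials, that is, the eigenvector components of [z ^ n] at
     [k]. *)
  set K1 := z ^ k * ((1 + cfun a1 a2 b1 b2 k z / hfun a1 a2 b1 b2 z) / 2).
  set K2 := z ^ k * ((1 - cfun a1 a2 b1 b2 k z / hfun a1 a2 b1 b2 z) / 2).
  transitivity (\int[P]_w
      ((c * K1)%:E * (expR (hhat_plus a1 a2 b1 b2 z * T t w))%:E
       + (c * K2)%:E * (expR (hhat_minus a1 a2 b1 b2 z * T t w))%:E))%E.
    apply: eq_integral => w _.
    rewrite esumZl ?(ltW c0)//; last first.
      by move=> n; rewrite lee_fin mulr_ge0 ?(trans_ge0 hp)// exprz_ge0// ltW.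
    by rewrite G -!EFinM -EFinD -/K1 -/K2; congr (_%:E); ring.
  have L (gamma : R) : (\int[P]_w (expR (gamma * T t w))%:E =
      (mittag_leffler nu (gamma * t `^ nu))%:E)%E.
    by rewrite -hTL// unlock.
  rewrite integralD//; [|exact: integrableZl..].
  rewrite !integralZl// !L -/Eplus -/Eminus -!EFinM -EFinD; congr (_%:E).
  by rewrite /F /K1 /K2; field; rewrite gt_eqF// hfun_gt0.
split.
- rewrite /cond_expectation integral_int_valued//; last first.
    by move=> n; rewrite exprz_ge0// ltW.
  rewrite key PA -/c -EFinM; congr (_%:E).
  by rewrite mulrAC divff ?mul1r// gt_eqF.
- transitivity (\esum_(n in [set: int])
    ((c^-1)%:E * ((z ^ n)%:E * P (start `&` Xnu t @^-1` [set n]))))%E.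
    apply: eq_esum => n _; rewrite /cond_prob PA -/c setIC.
    rewrite -[P (start `&` _)]fineK ?fin_num_measure//; last exact: measurableI.
    by rewrite -!EFinM /= mulrA mulrC.
  rewrite esumZl ?invr_ge0 ?(ltW c0)//; last first.
    by move=> n; rewrite mule_ge0// lee_fin exprz_ge0// ltW.
  by rewrite key -EFinM mulrA mulVf ?mul1r// gt_eqF.
Qed.
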